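(* There is an Isbell decision tree, with real payoffs at terminal nodes, in which the team can achieve, with some classical exchangeable signals, an expected payoff strictly higher than the expected payoff of every strategy profile under any classical i.i.d. signals.
   Context: Isbell decision tree: a finite rooted tree whose non-terminal nodes are partitioned into decision nodes (of the team) and (possibly no) chance nodes of Nature. Decision nodes are partitioned into information sets $I$; all nodes in an information set have the same number of outgoing branches, with a given 1-1 correspondence between the outgoing branches of different nodes of the set, so each $I$ has a well-defined move set $M_I$. Some path from the root to a terminal node crosses some information set $I$ of the team more than once. At each chance node Nature's move is drawn from a given probability distribution, independently across chance nodes. Each terminal node $z$ carries a real payoff $u(z)$; $\nu(z)$ denotes the product of the probabilities of Nature's branches along the path to $z$ (equal to $1$ if there are none). Classical signals: each information set $I$ has a finite non-empty signal set $\Omega_I$, and each decision node $n$, belonging to information set $I(n)$, carries its own signal $\omega_n\in\Omega_{I(n)}$; the signals have a joint distribution $\mu$, a probability measure on $\prod_n \Omega_{I(n)}$ (product over all decision nodes), independent of Nature. Exchangeable: $\mu$ is invariant under every permutation of the decision nodes that maps each information set to itself. I.i.d.: $\mu$ is exchangeable and, for each information set $I$, the signals $(\omega_n)_{n\in I}$ are mutually independent (hence i.i.d.) under $\mu$. Strategy profiles: tuples $f=(f_I)_I$ of maps $f_I:\Omega_I\to M_I$ (the same map is used at all nodes of $I$). The expected payoff of $f$ is $$\sum_z \nu(z)\,\mu\big(\{\omega : f_{I(n)}(\omega_n) = m_n^z \text{ for every decision node } n \text{ on the path to } z\}\big)\,u(z),$$ where $z$ ranges over terminal nodes and $m^z_n$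 is the move taken at $n$ by the path to $z$. *)

(* Defs.v *)
From mathcomp Require Import all_boot all_order all_algebra all_fingroup.
From mathcomp Require Import reals.

Set Implicit Arguments.
Unset Strict Implicit.
Unset Printing Implicit Defensive.

Import Order.TTheory GRing.Theory Num.Theory.

Local Open Scope ring_scope.

(* The decision nodes are given as the disjoint union of the information sets:
   [dnode i] is the set of nodes of the information set [i].  All nodes of [i]
   have their outgoing branches indexed by the same move set [move i], which is
   the 1-1 correspondence between the branches of different nodes of [i]. *)
Record arena := Arena {
  infoset : finType;
  dnode : infoset -> finType;
  move : infoset -> finType;
  cnode : finType;
  branch : cnode -> finType;
  tnode : finType;
  tree_root : {i : infoset & dnode i} + cnode + tnode;
  dchild : forall i, dnode i -> move i -> {i : infoset & dnode i} + cnode + tnode;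
  cchild : forall c, branch c -> {i : infoset & dnode i} + cnode + tnode
}.
Arguments tree_root : clear implicits.

Definition decision_node (A : arena) := {i : infoset A & dnode i}.
Definition node (A : arena) := (decision_node A + cnode A + tnode A)%type.

Definition terminal (A : arena) (z : tnode A) : node A := inr z.

Definition edge (A : arena) :=
  ({n : decision_node A & move (tag n)} + {c : cnode A & branch c})%type.

Definition source (A : arena) (e : edge A) : node A :=
  match e with
  | inl d => inl (inl (tag d))
  | inr c => inl (inr (tag c))
  end.

Definition target (A : arena) (e : edge A) : node A :=
  match e with
  | inl d => dchild (tagged (tag d)) (tagged d)
  | inr c => cchild (tagged c)
  end.

Fixpoint walk (A : arena) (v : node A) (p : seq (edge A)) (w : node A) : bool :=
  if p is e :: p' then (source e == v) && walk (target e) p' w else v == w.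

(* [walk_ex] and [walk_uniq] say that every node is reached from the root by
   exactly one sequence of branches, i.e. that the arena is a rooted tree. *)
Record decision_tree (R : realType) := DecisionTree {
  tree_arena :> arena;
  dnode_gt0 : forall i : infoset tree_arena, (0 < #|dnode i|)%N;
  move_gt0 : forall i : infoset tree_arena, (0 < #|move i|)%N;
  walk_ex : forall v : node tree_arena,
    exists p, walk (tree_root tree_arena) p v;
  walk_uniq : forall (v : node tree_arena) p q,
    walk (tree_root tree_arena) p v -> walk (tree_root tree_arena) q v -> p = q;
  nature : forall c : cnode tree_arena, branch c -> R;
  nature_ge0 : forall (c : cnode tree_arena) (b : branch c), 0 <= nature b;
  nature_sum1 : forall c : cnode tree_arena, \sum_(b : branch c) nature b = 1;
  utility : tnode tree_arena -> R
}.

Definition path_to (R : realType) (T : decision_tree R) (z : tnode T) :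
  seq (edge T) := xchoose (walk_ex (terminal z)).

Definition crosses (A : arena) (i : infoset A) (e : edge A) : bool :=
  if e is inl d then tag (tag d) == i else false.

Definition isbell (R : realType) (T : decision_tree R) : Prop :=
  exists (z : tnode T) (i : infoset T), (1 < count (crosses i) (path_to z))%N.

Definition edge_prob (R : realType) (T : decision_tree R) (e : edge T) : R :=
  if e is inr c then nature (tagged c) else 1.

Definition nature_prob (R : realType) (T : decision_tree R) (z : tnode T) : R :=
  \prod_(e <- path_to z) edge_prob e.

(* A realization assigns to each decision node of [i] its own signal in
   [Omega i]; [w i n] is the signal of the node [n] of [i]. *)
Definition realization (A : arena) (Omega : infoset A -> finType) :=
  {dffun forall i : infoset A, {ffun dnode i -> Omega i}}.

(* The joint distribution of the signals is given by its mass function. *)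
Record signals (R : realType) (A : arena) := Signals {
  Omega : infoset A -> finType;
  Omega_gt0 : forall i, (0 < #|Omega i|)%N;
  mass : realization Omega -> R;
  mass_ge0 : forall w, 0 <= mass w;
  mass_sum1 : \sum_w mass w = 1
}.

Definition Pr (R : realType) (A : arena) (S : signals R A)
  (E : {set realization (Omega S)}) : R := \sum_(w in E) mass w.

(* A permutation of the decision nodes that maps each information set to itself
   is a family of permutations, one for each information set. *)
Definition permute_signals (A : arena) (Om : infoset A -> finType)
    (s : forall i : infoset A, {perm dnode i}) (w : realization Om) :
  realization Om := [ffun i => [ffun n => w i (s i n)]].

Definition exchangeable (R : realType) (A : arena) (S : signals R A) : Prop :=
  forall (s : forall i : infoset A, {perm dnode i}) (E : {set realization (Omega S)}),
    Pr [set w | permute_signals s w \in E] = Pr E.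

Definition mutually_independent (R : realType) (A : arena) (S : signals R A)
    (i : infoset A) : Prop :=
  forall (J : {set dnode i}) (B : dnode i -> {set Omega S i}),
    Pr [set w : realization (Omega S) | [forall n in J, w i n \in B n]] =
    \prod_(n in J) Pr [set w : realization (Omega S) | w i n \in B n].

Definition iid (R : realType) (A : arena) (S : signals R A) : Prop :=
  exchangeable S /\ forall i, mutually_independent S i.

Definition profile (R : realType) (A : arena) (S : signals R A) :=
  forall i : infoset A, Omega S i -> move i.

Definition follows (R : realType) (A : arena) (S : signals R A) (f : profile S)
    (w : realization (Omega S)) (e : edge A) : bool :=
  if e is inl d then f (tag (tag d)) (w (tag (tag d)) (tagged (tag d))) == tagged d
  else true.

Definition expected_payoff (R : realType) (T : decision_tree R)
    (S : signals R T) (f : profile S) : R :=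
  \sum_(z : tnode T)
    nature_prob z * Pr [set w | all (follows f w) (path_to z)] * utility z.

(* Main.v *)
Require Import Defs.
From mathcomp Require Import all_boot all_order all_algebra all_fingroup.
From mathcomp Require Import reals.
From mathcomp Require Import lra.

(** In the absent-minded driver's tree the team moves at most twice, in a single
    information set with two moves, and gets 1 exactly when its first move is
    [true] and its second is [false].  Under i.i.d. signals the two moves are
    independent with a common law, so the payoff is [p (1 - p) <= 1/4].  Fair
    signals that are always different at the two nodes are exchangeable and give
    1/2. *)

Set Implicit Arguments.
Unset Strict Implicit.
Unset Printing Implicit Defensive.

Import Order.TTheory GRing.Theory Num.Theory.

Local Open Scope ring_scope.

Lemma permute_signals_inj (A : arena) (Om : infoset A -> finType)
    (s : forall i : infoset A, {perm dnode i}) :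
  injective (@permute_signals A Om s).
Proof.
move=> w1 w2 /ffunP eqw; apply/ffunP => i; apply/ffunP => n.
by have /ffunP/(_ ((s i)^-1%g n)) := eqw i; rewrite !ffunE permKV.
Qed.

(** Relabelling nodes permutes the finite set of realizations, so reindexing sums carries invariance
    from single masses to events. *)
Lemma exchangeable_mass (R : realType) (A : arena) (S : signals R A) :
  (forall s (w : realization (Omega S)), mass (permute_signals s w) = mass w) ->
  exchangeable S.
Proof.
move=> massE s E; rewrite /Pr [RHS](reindex_inj (@permute_signals_inj _ _ s)).
by apply: eq_big => [w|w _]; rewrite ?inE ?massE.
Qed.

Lemma Pr_setC (R : realType) (A : arena) (S : signals R A)
    (E : {set realization (Omega S)}) : Pr (~: E) = 1 - Pr E.
Proof.
rewrite -(mass_sum1 S) (bigID (mem E)) /= addrAC /Pr subrr add0r.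
by apply: eq_bigl => w; rewrite inE.
Qed.

Definition driver_node (n : bool) : {i : unit & bool} + void + option bool :=
  inl (inl (existT (fun _ => bool) tt n)).

(* Node [true] is the root. *)
Definition driver_child (n m : bool) : {i : unit & bool} + void + option bool :=
  if n then if m then driver_node false else inr None else inr (Some m).

(** Terminal [None] is the exit at the root; [Some m] is the end after the moves [true] and [m]. The
    empty type rules out chance nodes. *)
Definition driver_arena : arena :=
  @Arena unit (fun _ => bool) (fun _ => bool) void (fun _ => unit) (option bool)
    (driver_node true) (fun _ => driver_child) (fun c _ => of_void _ c).

Definition driver_edge (n m : bool) : edge driver_arena :=
  inl (existT (fun k : decision_node driver_arena => move (tag k))
         (existT (fun _ => bool) tt n) m).

Definition driver_path (v : node driver_arena) : seq (edge driver_arena) :=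
  match v with
  | inl (inl (existT _ true)) => [::]
  | inl (inl (existT _ false)) => [:: driver_edge true true]
  | inl (inr _) => [::]
  | inr None => [:: driver_edge true false]
  | inr (Some m) => [:: driver_edge true true; driver_edge false m]
  end.

Lemma driver_walk_ex (v : node driver_arena) :
  exists p, walk (tree_root driver_arena) p v.
Proof.
by exists (driver_path v); case: v => [[[[] []]|[]]|[[]|]]; rewrite /= ?eqxx.
Qed.

(** The source of each edge fixes its node, and no edge leaves a terminal, so case analysis on at
    most two edges is exhaustive. *)
Lemma driver_walkE (v : node driver_arena) p :
  walk (tree_root driver_arena) p v -> p = driver_path v.
Proof.
have end_terminal z q : walk (inr z : node driver_arena) q v -> v = inr z /\ q = [::].
  by case: q => [/eqP<-|[[[[] n] m]|[[] ?]] q].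
case: p => [/eqP<- //|[[[[] []] m]|[[] ?]] p] /andP[/eqP// _] /=.
case: m => [|/end_terminal[-> ->] //].
case: p => [/eqP<- //|[[[[] []] m]|[[] ?]] p] /andP[/eqP// _] /=.
by move/end_terminal=> [-> ->].
Qed.

Lemma driver_walk_uniq (v : node driver_arena) p q :
  walk (tree_root driver_arena) p v -> walk (tree_root driver_arena) q v -> p = q.
Proof. by move=> /driver_walkE-> /driver_walkE->. Qed.

Section Driver.

Variable R : realType.

Definition driver_tree : decision_tree R.
Proof.
refine (@DecisionTree R driver_arena _ _ driver_walk_ex driver_walk_uniq
  (fun _ _ => 1) _ _ (fun z => (z == Some false)%:R)).
- by move=> i; rewrite card_bool.
- by move=> i; rewrite card_bool.
- by case.
- by case.
Defined.

(** [path_to] is a choice that does not compute; uniqueness of walks makes it explicit. *)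
Lemma driver_path_to (z : tnode driver_tree) : path_to z = driver_path (inr z).
Proof. exact/driver_walkE/(xchooseP (walk_ex (terminal z))). Qed.

Lemma driver_isbell : isbell driver_tree.
Proof. by exists (Some false), tt; rewrite driver_path_to. Qed.

(** Only the terminal [Some false] pays, and Nature contributes the factor 1. *)
Lemma driver_payoff (S : signals R driver_tree) (f : profile S) :
  expected_payoff f =
  Pr [set w : realization (Omega S) | f tt (w tt true) && ~~ f tt (w tt false)].
Proof.
rewrite /expected_payoff (bigD1 (Some false)) //= big1 => [|z /negPf nz]; last first.
  by rewrite /= nz mulr0.
rewrite addr0 mulr1 /nature_prob driver_path_to !big_cons big_nil /= !mul1r.
by congr Pr; apply/setP => w; rewrite !inE /= andbT eqb_id eqbF_neg.
Qed.

Lemma driver_iid_payoff (S : signals R driver_tree) (f : profile S) :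
  iid S -> expected_payoff f <= 4^-1.
Proof.
case=> exS indS; rewrite driver_payoff.
(* The move wanted at node [n] happens to be [n] itself: [true] at the root, [false] below. *)
pose B (n : bool) := [set x : Omega S tt | f tt x == n].
have := indS tt setT B.
rewrite (eq_bigl xpredT) => [|n]; last by rewrite inE.
rewrite big_bool /=.
(* Exchangeability under the swap of the two nodes gives both moves the same law. *)
have -> : Pr [set w : realization (Omega S) | w tt false \in B false] =
          1 - Pr [set w : realization (Omega S) | w tt true \in B true].
  rewrite -Pr_setC -[RHS](exS (fun _ => tperm true false)).
  congr Pr; apply/setP => w; rewrite !inE !ffunE tpermL.
  by case: (f tt _).
have -> : [set w : realization (Omega S) | [forall n in [set: bool], w tt n \in B n]] =
   [set w : realization (Omega S) | f tt (w tt true) && ~~ f tt (w tt false)].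
  apply/setP => w; rewrite !inE; apply/forall_inP/andP => [h|[h1 h2] [] _].
  - have := h true (in_setT _); have := h false (in_setT _).
    by rewrite !inE eqb_id eqbF_neg.
  - by rewrite inE h1.
  - by rewrite inE eqbF_neg.
move=> ->; set p := Pr _.
(* Here [p * (1 - p) = 1/4 - (p - 1/2)^2]. *)
have := sqr_ge0 (p - 2^-1); nra.
Qed.

Definition opposite_mass (w : realization (A := driver_tree) (fun _ => bool)) : R :=
  (w tt true != w tt false)%:R / 2.

Lemma opposite_mass_ge0 w : 0 <= opposite_mass w.
Proof. by rewrite divr_ge0. Qed.

(** The root gets signal [b] and the other node gets [~~ b]; these two realizations support
    [opposite_mass]. *)
Definition opposite_realization (b : bool) :
    realization (A := driver_tree) (fun _ => bool) :=
  [ffun=> [ffun n : bool => n == b]].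

Lemma eq_opposite_realization w b :
  (w == opposite_realization b) = (w tt true == b) && (w tt false != b).
Proof.
apply/eqP/andP => [->|[/eqP w1 w0]]; first by rewrite !ffunE; case: b.
apply/ffunP => -[]; apply/ffunP => -[]; rewrite !ffunE.
  by rewrite w1; case: b w1 w0.
by case: (w tt false) w0; case: b w1.
Qed.

Lemma opposite_mass_sum1 : \sum_w opposite_mass w = 1.
Proof.
(* The mass is split into two point masses of weight 1/2, each summed separately. *)
transitivity (\sum_w \sum_b (w == opposite_realization b)%:R / 2 : R).
  apply: eq_bigr => w _; rewrite big_bool /= !eq_opposite_realization /opposite_mass.
  by case: (w tt true); case: (w tt false); rewrite /= ?mul0r ?addr0 ?add0r.
rewrite exchange_big big_bool /=.
have sum_half b : \sum_w (w == opposite_realization b)%:R / 2 = 2^-1 :> R.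
  rewrite (bigD1 (opposite_realization b)) //= eqxx mul1r big1 ?addr0 // => w /negPf->.
  by rewrite mul0r.
by rewrite !sum_half; lra.
Qed.

Definition opposite_signals : signals R driver_tree :=
  @Signals R driver_tree (fun _ => bool) (fun _ => ltnW (eq_leq (esym card_bool)))
    opposite_mass opposite_mass_ge0 opposite_mass_sum1.

Lemma opposite_exchangeable : exchangeable opposite_signals.
Proof.
apply: exchangeable_mass => s w; rewrite /= /opposite_mass !ffunE.
(* A permutation keeps the two nodes distinct, and the mass is symmetric in their signals. *)
have : s tt true != s tt false by rewrite (inj_eq perm_inj).
by case: (s tt true); case: (s tt false) => // _; rewrite eq_sym.
Qed.

(** When each signal is played as the move, the paying event is the single realization
    [opposite_realization true]. *)
Lemma opposite_payoff :
  expected_payoff (S := opposite_signals) (fun _ x => x) = 2^-1.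
Proof.
rewrite driver_payoff /Pr (big_pred1 (opposite_realization true)) => [|w].
  by rewrite /= /opposite_mass !ffunE mul1r.
by rewrite inE [RHS]eq_opposite_realization !eqb_id.
Qed.

End Driver.

Theorem mainTheorem5 (R : realType) :
  exists T : decision_tree R, isbell T /\
    exists (S : signals R T) (f : profile S), exchangeable S /\
      forall (S' : signals R T) (f' : profile S'), iid S' ->
        expected_payoff f' < expected_payoff f.
Proof.
exists (driver_tree R); split; first exact: driver_isbell.
exists (opposite_signals R), (fun _ x => x); split; first exact: opposite_exchangeable.
move=> S f /driver_iid_payoff payoff_le.
by rewrite opposite_payoff; apply: le_lt_trans (payoff_le f) _; lra.
Qed.
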